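(* Let $T$ be the Syracuse map on odd positive integers. For odd $n$, the valuation sequence $a_j(n)=v_2(3T^j(n)+1)$ ($j\ge 0$) decomposes uniquely into consecutive blocks $(1,\ldots,1,r_i)$, $i=1,2,\ldots$, consisting of $L_i\ge 0$ entries equal to $1$ followed by one entry $r_i\ge 2$ (a ''run-compensate cycle''). Write $n^{(k)}=T^{L_1+\cdots+L_k+k}(n)$ for the value after $k$ complete cycles, and let $\mathcal N_k=\{n \text{ odd}: n^{(k)}\ge n\}$. Let $X=(L+1)\log_2 3-(L+r)$, where $L$ and $r$ are independent random variables with $\Pr(L=\ell)=2^{-(\ell+1)}$ for $\ell\ge 0$ and $\Pr(r=k)=2^{-(k-1)}$ for $k\ge 2$, let $M_X(t)=\mathbb E[e^{tX}]$, and let $I(0)=\sup_t\{-\log M_X(t)\}$ (the Cramér rate function of $X$ at $0$; numerically $I(0)\approx 0.1465$). Then for every $k\ge 1$ the upper natural density of $\mathcal N_k$ within the odd positive integers satisfies $\overline d(\mathcal N_k)\le e^{-I(0)k}$. Consequently $\overline d\bigl(\bigcap_{k\ge 1}\mathcal N_k\bigr)=0$.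
   Context: $T(n)=(3n+1)/2^{v_2(3n+1)}$ for odd $n$; $v_2$ is the $2$-adic valuation; $T^j$ is the $j$-th iterate. Natural/upper density is taken relative to the set of odd positive integers. *)

(* Defs.v *)
From HB Require Import structures.
From mathcomp Require Import all_boot all_order all_algebra.
From mathcomp Require Import all_classical all_reals all_analysis.
Unset Printing Implicit Defensive.
Import Order.TTheory GRing.Theory Num.Theory.

Definition v2 (m : nat) : nat := logn 2 m.

Definition syracuse (n : nat) : nat := (3 * n + 1) %/ 2 ^ v2 (3 * n + 1).

Definition aval (n j : nat) : nat := v2 (3 * iter j syracuse n + 1).

(* [cycle_end n k j] : j = L_1 + ... + L_k + k, i.e. the k-th
   run-compensate block (1,...,1,r_k) of the valuation sequence of n
   occupies positions up to j-1: exactly k entries >= 2 occur among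
   a_0,...,a_{j-1}, and the last of them is a_{j-1}. *)
Definition cycle_end (n k j : nat) : bool :=
  (count (fun i => 2 <= aval n i) (iota 0 j) == k) && (2 <= aval n j.-1).

Definition Nset (k : nat) : set nat :=
  [set n | odd n /\ exists j, cycle_end n k j /\ (n <= iter j syracuse n)%N].

Local Open Scope ring_scope.

Definition odd_ratio (R : realType) (A : set nat) (N : nat) : R :=
  (\sum_(0 <= n < N.+1 | odd n) (\1_A n : R)) /
  (\sum_(0 <= n < N.+1 | odd n) (1 : R)).

Definition upper_density (R : realType) (A : set nat) : \bar R :=
  limn_esup (fun N => (odd_ratio R A N)%:E).

Definition pmfLr (R : realType) (l k : nat) : R :=
  (2^-1) ^+ l.+1 * (2^-1) ^+ k.-1.

Definition log2_3 (R : realType) : R := ln 3 / ln 2.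

Definition Xval (R : realType) (l k : nat) : R :=
  (l.+1)%:R * log2_3 R - (l + k)%:R.

Definition MX (R : realType) (t : R) : \bar R :=
  (\sum_(0 <= l <oo) \sum_(2 <= k <oo) (pmfLr R l k * expR (t * Xval R l k))%:E)%E.

(* Cramer rate at 0: I(0) = sup_t { - log M_X(t) }; values of t with
   M_X(t) = +oo give -log M_X(t) = -oo and do not contribute. *)
Definition I0 (R : realType) : R :=
  sup [set - ln (fine (MX R t)) | t in [set t : R | (MX R t < +oo)%E]].

(* Main.v *)
Require Import Defs.
From HB Require Import structures.
From mathcomp Require Import all_boot all_order all_algebra.
From mathcomp Require Import all_classical all_reals all_analysis.
From mathcomp Require Import zify ring lra.
Import Order.TTheory GRing.Theory Num.Theory.
Local Open Scope classical_set_scope.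
Local Open Scope ring_scope.

(** Odd numbers whose valuation sequence starts with a_0, ..., a_(j-1) of sum s
    are congruent mod 2^(s+1), and on that class T^j n = (3^j n + c) / 2^s with
    c constant; so [n <= T^j n] leaves only finitely many n unless 2^s <= 3^j,
    in which case 2^-s <= u^j y^s with u = e^(t log2 3), y = e^-t / 2, for every
    t >= 0. Summing u^j y^s over all patterns of k cycles gives M_X(t)^k; the
    patterns having a long run of ones or a high compensation r carry density
    O(k 2^-B), so only finitely many residue classes have to be added up.
    With x = u y, M_X(t) = x/(1-x) * y/(1-y); it is >= 1 iff x + y >= 1,
    which holds for t <= 0 because log2 3 < 2, so negative t do not contribute;
    and it is < 1 at t = (ln 2)/2, whence I(0) > 0. *)

(** * Valuation prefixes of the Syracuse map *)

Lemma syracuseE (n : nat) :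
  (2 ^ v2 (3 * n + 1) * syracuse n = 3 * n + 1)%N.
Proof. by rewrite mulnC divnK// pfactor_dvdnn. Qed.

Lemma odd_syracuse (n : nat) : odd (syracuse n).
Proof.
have n0 : (0 < 3 * n + 1)%N by rewrite addn1.
have [m cm e] := pfactor_coprime (isT : prime 2) n0.
have := syracuseE n; rewrite [RHS]e /v2 mulnC.
by move/eqP; rewrite eqn_pmul2r ?expn_gt0// => /eqP ->; rewrite -coprime2n.
Qed.

Lemma odd_iter_syracuse (n j : nat) : odd n -> odd (iter j syracuse n).
Proof. by case: j => //= j _; exact: odd_syracuse. Qed.

Lemma aval_gt0 (n j : nat) : odd n -> (0 < aval n j)%N.
Proof.
move=> on; rewrite /aval /v2 logn_gt0 mem_primes/= addn1/= dvdn2/= oddM/=.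
by rewrite odd_iter_syracuse.
Qed.

Definition has_prefix (a : seq nat) (n : nat) : Prop :=
  forall i, (i < size a)%N -> aval n i = nth 0%N a i.

Lemma has_prefix_rcons (a : seq nat) (r n : nat) :
  has_prefix (rcons a r) n <-> has_prefix a n /\ aval n (size a) = r.
Proof.
split=> [h|[h hr] i].
  split=> [i ia|].
    by rewrite h ?size_rcons ?ltnS ?(ltnW ia)// nth_rcons ia.
  by rewrite h ?size_rcons// nth_rcons ltnn eqxx.
rewrite size_rcons ltnS leq_eqVlt nth_rcons => /orP[/eqP ->|ia].
  by rewrite ltnn eqxx.
by rewrite ia h.
Qed.

Lemma has_prefix_ones (a : seq nat) (l n : nat) : has_prefix a n ->
  (forall i, (i < l)%N -> aval n (size a + i) = 1%N) ->
  has_prefix (a ++ nseq l 1%N) n.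
Proof.
move=> h hl i; rewrite size_cat size_nseq nth_cat => il.
case: ltnP => ia; first exact: h.
rewrite nth_nseq ltn_subLR// il -(hl (i - size a)%N) ?subnKC//.
by rewrite ltn_subLR.
Qed.

(* Along a fixed prefix, T^j n = (3^j n + c) / 2^s with c independent of n. *)
Lemma has_prefix_affine (a : seq nat) (n m : nat) :
  has_prefix a n -> has_prefix a m ->
  (2 ^ sumn a * iter (size a) syracuse n + 3 ^ size a * m =
   2 ^ sumn a * iter (size a) syracuse m + 3 ^ size a * n)%N.
Proof.
elim/last_ind: a => [|a r ih]; first by rewrite /= !mul1n addnC.
move=> /has_prefix_rcons[hn rn] /has_prefix_rcons[hm rm].
have := syracuseE (iter (size a) syracuse n).
have := syracuseE (iter (size a) syracuse m).
rewrite -!/(aval _ _) rn rm size_rcons sumn_rcons expnD -!mulnA !iterS.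
move=> -> ->; rewrite expnS; have := ih hn hm; lia.
Qed.

(** The affine relation gives 3^(j+1) (m - n) = 2^s ((3y+1) - (3x+1)) with x, y the j-th iterates of
    n, m, and powers of 3 are invertible mod powers of 2. The parameter [b] encodes partial
    knowledge of the next valuation, namely that it is at least [b]. *)
Lemma has_prefix_modn (a : seq nat) (b n m : nat) :
  has_prefix a n -> has_prefix a m ->
  (2 ^ b %| 3 * iter (size a) syracuse n + 1)%N ->
  (2 ^ b %| 3 * iter (size a) syracuse m + 1)%N ->
  (n = m %[mod 2 ^ (sumn a + b)])%N.
Proof.
wlog nm : n m / (n <= m)%N => [wl hn hm bn bm|].
  by case: (leqP n m) => [/wl|/ltnW /wl h]; [exact|apply/esym; exact: h].
move=> hn hm bn bm; apply/eqP; rewrite eq_sym eqn_mod_dvd//.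
have c3 : coprime (2 ^ (sumn a + b)) (3 ^ (size a).+1).
  exact/coprimeXl/coprimeXr.
rewrite -(Gauss_dvdr _ c3).
have := has_prefix_affine a n m hn hm.
move: bn bm; set x := iter _ _ n; set y := iter _ _ m => bn bm e.
have -> : (3 ^ (size a).+1 * (m - n) =
    2 ^ sumn a * ((3 * y + 1) - (3 * x + 1)))%N.
  by rewrite expnS !mulnBr !mulnDr; lia.
by rewrite expnD dvdn_mul ?dvdn_sub.
Qed.

(** * Run-compensate cycles *)

Fixpoint cycles (n i k j : nat) : Prop :=
  if k is k'.+1 then
    exists l, [/\ forall i', (i' < l)%N -> aval n (i + i') = 1%N,
      (2 <= aval n (i + l))%N & cycles n (i + l).+1 k' j]
  else j = i.

(** Induction on the number m of entries left from position i: an entry 1 lengthens the first run of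
    the remaining cycles, an entry at least 2 closes a cycle with an empty run. *)
Lemma cycle_end_cycles (n k j : nat) : odd n ->
  cycle_end n k j -> cycles n 0 k j.
Proof.
move=> on /andP[/eqP ck lj].
suff h m : forall i k, count (fun i => 2 <= aval n i)%N (iota i m) = k ->
    ((0 < m)%N -> (2 <= aval n (i + m).-1)%N) -> cycles n i k (i + m).
  by apply: (h j 0%N).
clear k j ck lj; elim: m => [|m ih] i k /=; first by move=> <- _; rewrite addn0.
move=> ek /(_ isT); rewrite addnS/= => lm.
have := ih i.+1; rewrite addSn/= => {}ih.
have := aval_gt0 n i on; rewrite leq_eqVlt => /orP[/eqP e1|e2].
  (* A last entry equal to 1 is excluded, so something follows it. *)
  have m0 : (0 < m)%N by move: lm; case: (m) => //; rewrite addn0 -e1.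
  move: ek; rewrite -e1 add0n => ek.
  have := ih k ek (fun=> lm); case: k {ek} => [/=|k [l [h1 h2 h3]]].
    by move=> /eqP; rewrite -addSn -[X in _ == X]addn0 eqn_add2l; case: (m) m0.
  exists l.+1; split; rewrite ?addnS -?addSn//.
  by move=> [|i'] il; rewrite ?addn0// addnS -addSn h1.
case: k ek => [|k]; rewrite e2//= => -[ek].
by exists 0%N; rewrite addn0; split => //; apply: ih.
Qed.

(** * Linear bounds on counting functions *)

Definition odd_count {R : realType} (A : set nat) (N : nat) : R :=
  \sum_(0 <= n < N.+1 | odd n) \1_A n.

(* Unlike an upper density bound, this linear bound on the counting function
   is additive under finite unions without any epsilon. *)
Definition density_le {R : realType} (A : set nat) (x : R) : Prop :=
  exists C : R, forall N, odd_count A N <= x * odd_count setT N + C.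

Section density.
Context {R : realType}.
Implicit Types (A B : set nat) (x y : R).

Lemma odd_count_le A B N : (forall n, odd n -> A n -> B n) ->
  (odd_count A N : R) <= odd_count B N.
Proof.
move=> AB; apply: ler_sum => n on; rewrite !indicE ler_nat.
by case: (boolP (n \in A)) => // /set_mem/(AB n on)/mem_set ->.
Qed.

Lemma density_le_sub A B x : (forall n, odd n -> A n -> B n) ->
  density_le B x -> density_le A x.
Proof.
by move=> AB [C hC]; exists C => N; exact: le_trans (odd_count_le _ _ _ AB) _.
Qed.

Lemma density_le_trans A x y : x <= y -> density_le A x -> density_le A y.
Proof.
move=> xy [C hC]; exists C => N; apply: le_trans (hC N) _.
by rewrite lerD2r ler_wpM2r// sumr_ge0.
Qed.

Lemma density_leU A B x y : density_le A x -> density_le B y ->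
  density_le (A `|` B) (x + y).
Proof.
move=> [C hC] [D hD]; exists (C + D) => N.
have : (odd_count (A `|` B) N : R) <= odd_count A N + odd_count B N.
  rewrite -big_split/=; apply: ler_sum => n _; rewrite !indicE in_setU.
  by rewrite -natrD ler_nat; case: (_ \in A); case: (_ \in B).
move=> /le_trans; apply; apply: le_trans (lerD (hC N) (hD N)) _.
by rewrite mulrDl addrACA.
Qed.

Lemma odd_count_inj A (f : nat -> nat) N D :
  (forall n, odd n -> A n -> (n <= N)%N -> (f n < D)%N) ->
  (forall n m, odd n -> odd m -> A n -> A m -> f n = f m -> n = m) ->
  (odd_count A N : R) <= D%:R.
Proof.
move=> fD finj.
pose s := [seq n <- iota 0 N.+1 | odd n && (n \in A)].
have -> : odd_count A N = (size s)%:R :> R.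
  rewrite size_filter -sum1_count natr_sum /odd_count big_mkcondr/=.
  rewrite /index_iota subn0; apply: eq_bigr => n _; rewrite indicE.
  by case: ifP.
have sP n : n \in s -> [/\ odd n, A n & (n <= N)%N].
  rewrite mem_filter mem_iota add0n ltnS.
  by move=> /andP[/andP[on /set_mem An]].
rewrite ler_nat -(size_map f) -(size_iota 0 D); apply: uniq_leq_size.
  rewrite map_inj_in_uniq ?filter_uniq ?iota_uniq// => n m.
  by move=> /sP[on An _] /sP[om Am _]; exact: finj.
move=> _ /mapP[n /sP[on An nN] ->].
by rewrite mem_iota add0n; exact: fD.
Qed.

Lemma density_le_bounded A K : (forall n, odd n -> A n -> (n <= K)%N) ->
  density_le A (0 : R).
Proof.
move=> AK; exists K.+1%:R => N; rewrite mul0r add0r.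
by apply: (odd_count_inj A id) => // n on An _; exact: AK.
Qed.

Lemma odd_count_setT N : N%:R / 2 <= odd_count setT N :> R.
Proof.
have -> : odd_count setT N = (uphalf N)%:R :> R.
  rewrite /odd_count; elim: N => [|N ih]; first by rewrite big_mkcond big_nat1.
  rewrite big_mkcond big_nat_recr//= -big_mkcond/= ih.
  rewrite indicE in_setT uphalf_half.
  by case: (odd N); rewrite /= ?addr0// addrC -natrD.
rewrite ler_pdivrMr// -natrM ler_nat; lia.
Qed.

(** All members share one residue, so the quotient by 2^(q+1) is injective on them and at most N /
    2^(q+1) + 1 of them are below N. Odd numbers have density 1/2, which turns 2^-(q+1) into
    2^-q. *)
Lemma density_le_modn A q :
  (forall n m, odd n -> odd m -> A n -> A m -> n = m %[mod 2 ^ q.+1])%N ->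
  density_le A (2^-1 ^+ q : R).
Proof.
move=> Aq; exists 1 => N.
apply: (@le_trans _ _ (N %/ 2 ^ q.+1).+1%:R).
  apply: (odd_count_inj A (fun n => n %/ 2 ^ q.+1)%N) => [n _ _ nN|].
    by rewrite ltnS leq_div2r.
  move=> n m on om An Am e.
  by rewrite (divn_eq n (2 ^ q.+1)) e (Aq n m)// -divn_eq.
rewrite -natr1 lerD2r; apply: (@le_trans _ _ (2^-1 ^+ q * (N%:R / 2))).
  rewrite mulrCA -exprSr -[leRHS]mulr1 exprVn mulrAC mulr1.
  by rewrite ler_pdivlMr ?exprn_gt0// -natrX -natrM ler_nat leq_divM.
by rewrite ler_wpM2l ?exprn_ge0 ?odd_count_setT.
Qed.

Lemma density_le1 A : density_le A (1 : R).
Proof.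
rewrite -(expr0 2^-1); apply: density_le_modn => n m on om _ _.
by rewrite expn1 !modn2 on om.
Qed.

Lemma density_le_big (I : nat) (A : nat -> set nat) (x : nat -> R) :
  (forall i, (i < I)%N -> density_le (A i) (x i)) ->
  density_le [set n | exists2 i, (i < I)%N & A i n] (\sum_(i < I) x i).
Proof.
elim: I => [|I ih] h.
  by rewrite big_ord0; apply: (@density_le_bounded _ 0) => n _ [].
rewrite big_ord_recr/=.
have := density_leU _ _ _ _ (ih (fun i iI => h i (ltnW iI))) (h I (ltnSn I)).
apply: density_le_sub => n _ [i]; rewrite ltnS leq_eqVlt => /orP[/eqP ->|iI] Ai.
  by right.
by left; exists i.
Qed.

Lemma upper_density_ge0 A : (0 <= upper_density R A)%E.
Proof.
apply: limf_esup_ge0 => [|N].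
  by apply: filter_not_empty.
by rewrite lee_fin divr_ge0 ?sumr_ge0.
Qed.

Lemma upper_density_subset A B : (forall n, odd n -> A n -> B n) ->
  (upper_density R A <= upper_density R B)%E.
Proof.
move=> AB; rewrite /upper_density /limn_esup !limf_esupE.
apply: le_ereal_inf_tmp => _ [V FV <-]; apply: ge_ereal_inf.
exists (ereal_sup ((fun N => (odd_ratio R A N)%:E) @` V)); first by exists V.
apply: ge_ereal_sup => _ [N VN <-]; apply: le_ereal_sup_tmp.
exists (odd_ratio R B N)%:E; first by exists N.
rewrite lee_fin ler_wpM2r ?invr_ge0 ?sumr_ge0//.
exact: odd_count_le.
Qed.

Lemma upper_density_le A x : density_le A x -> (upper_density R A <= x%:E)%E.
Proof.
move=> [C hC]; apply/lee_addgt0Pr => e e0.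
(* Beyond [K] the constant is absorbed: |C| < e N/2, and at least N/2 odd numbers are counted. *)
pose K := (Num.truncn (2 * `|C| / e)).+1.
rewrite /upper_density /limn_esup limf_esupE; apply: ge_ereal_inf.
exists (ereal_sup ((fun N => (odd_ratio R A N)%:E) @` [set N | (K <= N)%N])).
  by exists [set N | (K <= N)%N] => //; exact: nbhs_infty_ge.
apply: ge_ereal_sup => _ [N /= KN <-].
rewrite -EFinD lee_fin /odd_ratio.
have -> : \sum_(0 <= n < N.+1 | odd n) 1 = odd_count setT N :> R.
  by apply: eq_bigr => n _; rewrite indicE in_setT.
have CN : `|C| / e < N%:R / 2.
  rewrite ltr_pdivlMr// mulrC mulrA; apply: (@lt_le_trans _ _ K%:R).
    exact: truncnS_gt.
  by rewrite ler_nat.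
have Z := odd_count_setT N.
have Z0 : 0 < odd_count setT N :> R.
  by apply: lt_le_trans Z; apply: le_lt_trans CN; rewrite divr_ge0// ltW.
rewrite ler_pdivrMr// mulrDl; apply: le_trans (hC N) _; rewrite lerD2l.
apply: le_trans (ler_norm C) _; rewrite mulrC -ler_pdivrMr//.
by apply: ltW; exact: lt_le_trans CN Z.
Qed.

End density.

(** * Weighted sums over cycle patterns *)

Lemma sum_geometric_le {R : realType} (x : R) (I : nat) : 0 <= x < 1 ->
  \sum_(i < I) x ^+ i.+1 <= x / (1 - x).
Proof.
move=> /andP[x0 x1]; rewrite ler_pdivlMr ?subr_gt0//.
have -> : (\sum_(i < I) x ^+ i.+1) * (1 - x) = x - x ^+ I.+1.
  elim: I => [|I ih]; first by rewrite big_ord0 mul0r expr1 subrr.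
  by rewrite big_ord_recr/= mulrDl ih [x ^+ I.+2]exprSr; ring.
by rewrite gerBl exprn_ge0.
Qed.

(** Fixing a prefix makes an induction on the number of remaining cycles possible; the empty prefix
    covers [Nset k]. *)
Definition cycles_Nset (a : seq nat) (k : nat) : set nat :=
  [set n | has_prefix a n /\
    exists2 j, cycles n (size a) k j & (n <= iter j syracuse n)%N].

Section prefix.
Context {R : realType}.

Lemma density_le_prefix (a : seq nat) (b : nat) :
  density_le [set n | has_prefix a n /\
                 (2 ^ b.+1 %| 3 * iter (size a) syracuse n + 1)%N]
    (2^-1 ^+ (sumn a + b) : R).
Proof.
apply: density_le_modn => n m _ _ [hn dn] [hm dm].
by rewrite -addnS; exact: has_prefix_modn.
Qed.


(* If 3^j < 2^s, then n <= T^j n = (3^j n + c) / 2^s bounds n. *)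
Lemma cycles_Nset0_bounded (a : seq nat) : (3 ^ size a < 2 ^ sumn a)%N ->
  exists K, forall n, cycles_Nset a 0 n -> (n <= K)%N.
Proof.
move=> lt32.
have [[m [hm _]]|h] := pselect (exists m, cycles_Nset a 0 m); last first.
  by exists 0%N => n Wn; case: h; exists n.
(* Any fixed member m serves as reference: the affine relation gives (2^s - 3^j) n <= 2^s T^j m, and
   2^s - 3^j >= 1. *)
exists (2 ^ sumn a * iter (size a) syracuse m)%N => n [hn [_ -> le_n]].
have := has_prefix_affine a n m hn hm.
set q := iter _ _ n in le_n *; set q' := iter _ _ m.
move: lt32 le_n; set A := (3 ^ _)%N; set B := (2 ^ _)%N => lt32 le_n e.
have : (B * n <= B * q)%N by rewrite leq_mul2l le_n orbT.
nia.
Qed.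

Variables (u y M : R).
Hypotheses (u0 : 0 <= u) (y01 : 0 <= y < 1) (uy1 : u * y < 1).
Hypothesis ge1 : forall j s, (2 ^ s <= 3 ^ j)%N ->
  2^-1 ^+ s <= u ^+ j * y ^+ s.

Hypothesis leM : (u * y) / (1 - u * y) * (y / (1 - y)) <= M.

(** Induction on k, splitting on the next cycle (l, r). A cycle adds l+1 entries of sum (l+1) +
    (r-1), so it multiplies the weight by (uy)^(l+1) y^(r-1), whose sum over all cycles is at most
    M. Truncating at [B] costs at most 2^-(s+B) for long runs and as much for all high r together,
    hence the factor 2k. *)
Lemma density_le_cycles_Nset (B k : nat) (a : seq nat) :
  density_le (cycles_Nset a k)
   (u ^+ size a * y ^+ sumn a * M ^+ k + (2 * k)%:R * 2^-1 ^+ (sumn a + B)).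
Proof.
have [y0 y1] := andP y01.
have M0 : 0 <= M.
  by apply: le_trans leM; apply: mulr_ge0; apply: divr_ge0;
    rewrite ?mulr_ge0 ?subr_ge0 // ltW.
elim: k a => [|k ih] a.
  rewrite expr0 mulr1 muln0 mul0r addr0.
  have [le23|lt32] := leqP (2 ^ sumn a) (3 ^ size a).
    apply: density_le_trans (ge1 _ _ le23) _.
    have := density_le_prefix a 0; rewrite addn0; apply: density_le_sub.
    move=> n on [hn _]; split => //.
    by rewrite expn1 dvdn2 addn1/= oddM/= odd_iter_syracuse.
  apply: (@density_le_trans _ _ 0); first by rewrite mulr_ge0 ?exprn_ge0.
  have [K hK] := cycles_Nset0_bounded a lt32.
  by apply: (density_le_bounded _ K) => n _; exact: hK.
pose ones l := a ++ nseq l 1%N.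
have size_ones l : size (ones l) = (size a + l)%N.
  by rewrite size_cat size_nseq.
have sumn_ones l : sumn (ones l) = (sumn a + l)%N.
  by rewrite sumn_cat sumn_nseq mul1n.
pose long := [set n | has_prefix (ones B) n].
(* Divisibility by 2^(B+2) captures all r >= B+2 at once; in [low] the index i stands for r - 2. *)
pose high l := [set n | has_prefix (ones l) n /\
   (2 ^ B.+2 %| 3 * iter (size (ones l)) syracuse n + 1)%N].
pose low l i := cycles_Nset (rcons (ones l) i.+2) k.
have hlong : density_le long (2^-1 ^+ (sumn a + B) : R).
  have := density_le_prefix (ones B) 0; rewrite addn0 sumn_ones.
  apply: density_le_sub => n on hn; split => //.
  by rewrite expn1 dvdn2 addn1/= oddM/= odd_iter_syracuse.
have hhigh l : density_le (high l) (2^-1 ^+ (sumn a + B) * 2^-1 ^+ l.+1 : R).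
  have := density_le_prefix (ones l) B.+1; rewrite sumn_ones -exprD.
  by congr (density_le _ (_ ^+ _)); lia.
have hlow l i : density_le (low l i)
   (u ^+ size a * y ^+ sumn a * M ^+ k * ((u * y) ^+ l.+1 * y ^+ i.+1) +
   (2 * k)%:R * 2^-1 ^+ (sumn a + B) * (2^-1 ^+ l.+1 * 2^-1 ^+ i.+1)).
  have := ih (rcons (ones l) i.+2).
  rewrite size_rcons sumn_rcons size_ones sumn_ones.
  congr density_le; congr (_ + _).
    by rewrite exprMn !exprS !exprD !exprS; ring.
  by rewrite -!mulrA; congr (_ * _); rewrite -!exprD; congr (_ ^+ _); lia.
have := density_leU _ _ _ _ (density_leU _ _ _ _ hlong
  (density_le_big B high _ (fun l _ => hhigh l)))
  (density_le_big B (fun l => [set n | exists2 i, (i < B)%N & low l i n]) _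
    (fun l _ => density_le_big B (low l) _ (fun i _ => hlow l i))).
move/(density_le_sub (cycles_Nset a k.+1)) => h.
apply: density_le_trans (h _) => [|n on [hn [j [l [h1 h2 h3]] jn]]]; last first.
  have [Bl|lB] := leqP B l.
    left; left; apply: has_prefix_ones => // i iB.
    by apply: h1; exact: leq_trans iB Bl.
  have hl : has_prefix (ones l) n by exact: has_prefix_ones.
  have [rB|Br] := ltnP (aval n (size a + l)) B.+2.
    right; exists l => //; exists (aval n (size a + l)).-2; first by lia.
    have e : (aval n (size a + l)).-2.+2 = aval n (size a + l) by lia.
    split; first by rewrite e; apply/has_prefix_rcons; rewrite size_ones.
    by exists j => //; rewrite size_rcons size_ones.
  left; right; exists l => //; split => //.
  rewrite size_ones; apply: dvdn_trans (pfactor_dvdnn 2 _).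
  exact: dvdn_exp2l.
(* With e = 2^-(s+B), the bounds add up to e + e S2 + u^j y^s M^k Sx Sy + 2k e S2^2, where S2 <= 1
   and Sx Sy <= M. *)
under [X in _ + X <= _]eq_bigr do rewrite big_split/= -!mulr_sumr.
rewrite big_split/= -!mulr_sumr -!mulr_suml.
set S2 := \sum_(i < B) 2^-1 ^+ i.+1.
set Sx := \sum_(i < B) (u * y) ^+ i.+1; set Sy := \sum_(i < B) y ^+ i.+1.
have half : S2 <= 1.
  have := @sum_geometric_le R 2^-1 B; rewrite -/S2.
  suff -> : (2^-1 / (1 - 2^-1) : R) = 1 by apply; lra.
  by field.
have S20 : 0 <= S2 by apply: sumr_ge0 => i _; rewrite exprn_ge0.
have SM : Sx * Sy <= M.
  apply: le_trans leM; apply: ler_pM;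
    try by apply: sumr_ge0 => i _; rewrite ?exprn_ge0 ?mulr_ge0.
    by apply: sum_geometric_le; rewrite mulr_ge0.
  exact: sum_geometric_le.
set e := 2^-1 ^+ (sumn a + B); have e0 : 0 <= e by rewrite exprn_ge0.
have c0 : 0 <= u ^+ size a * y ^+ sumn a * M ^+ k.
  by rewrite !mulr_ge0 ?exprn_ge0.
have -> : (2 * k.+1)%:R = (2 * k)%:R + 2 :> R.
  by rewrite -natrD; congr _%:R; lia.
rewrite exprSr mulrA.
have := ler_wpM2l c0 SM.
have SS : S2 * S2 <= 1 by nra.
have : (2 * k)%:R * e * (S2 * S2) <= (2 * k)%:R * e.
  by rewrite ler_piMr// mulr_ge0.
have : e * S2 <= e by rewrite ler_piMr.
lra.
Qed.

Lemma upper_density_Nset (k : nat) :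
  (upper_density R (Nset k) <= (M ^+ k)%:E)%E.
Proof.
apply/lee_addgt0Pr => e e0.
(* Since B < 2^B, this makes the truncation error 2k 2^-B at most e. *)
pose B := (Num.truncn ((2 * k)%:R / e)).+1.
have hB : (2 * k)%:R * 2^-1 ^+ B <= e.
  rewrite exprVn ler_pdivrMr ?exprn_gt0// mulrC -ler_pdivrMr//.
  apply: ltW; apply: (@lt_le_trans _ _ B%:R); first exact: truncnS_gt.
  by rewrite -natrX ler_nat ltnW// ltn_expl.
rewrite -EFinD; apply: upper_density_le.
apply: (density_le_sub _ (cycles_Nset [::] k)).
  move=> n _ [on [j [/(cycle_end_cycles _ _ _ on) cj le_n]]].
  by split=> //; exists j.
apply: density_le_trans (density_le_cycles_Nset B k [::]).
by rewrite /= !expr0 !mul1r add0n lerD2l.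
Qed.

End prefix.

(** * The moment generating function and its rate *)

Section moment.
Context {R : realType}.
Implicit Types t : R.

Lemma nneseries_geometric (z : R) : 0 <= z < 1 ->
  (\sum_(0 <= i <oo) (z ^+ i.+1)%:E = (z / (1 - z))%:E)%E.
Proof.
move=> /andP[z0 z1]; apply: cvg_lim => //.
under eq_fun do rewrite sumEFin.
apply: cvg_EFin; first exact: nearW.
have -> : fine \o (fun n => (\sum_(0 <= i < n) z ^+ i.+1)%:E) =
    series (geometric z z).
  by apply/funext => n /=; apply: eq_bigr => i _; rewrite /geometric/= exprS.
by apply: cvg_geometric_series; rewrite ger0_norm.
Qed.

Lemma nneseries_geometricy (z : R) : 1 <= z ->
  (\sum_(0 <= i <oo) (z ^+ i.+1)%:E = +oo)%E.
Proof.
move=> z1; apply: eq_infty => r.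
pose n := (Num.truncn r).+1.
have z0 : 0 <= z by exact: le_trans z1.
apply: (@le_trans _ _ (\sum_(0 <= i < n) (z ^+ i.+1)%:E)%E); last first.
  by apply: nneseries_lim_ge => i _ _; rewrite lee_fin exprn_ge0.
rewrite sumEFin lee_fin; apply: (@le_trans _ _ n%:R).
  exact/ltW/truncnS_gt.
rewrite -[n in leLHS]subn0 -sumr_const_nat; apply: ler_sum => i _.
exact: exprn_ege1.
Qed.

Definition tilt3 t : R := expR (t * log2_3 R).
Definition tilt2 t : R := expR (- t) / 2.

(** Writing l + k = (l+1) + (k-1) separates the two variables, so the double series becomes a
    product of geometric series. *)
Lemma MX_term t l k : (0 < k)%N ->
  pmfLr R l k * expR (t * Xval R l k) =
  (tilt3 t * tilt2 t) ^+ l.+1 * tilt2 t ^+ k.-1.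
Proof.
case: k => // k _; rewrite /pmfLr /Xval /tilt3 /tilt2 /=.
rewrite !exprMn -!expRM_natl.
rewrite [RHS](_ : _ = 2^-1 ^+ l.+1 * 2^-1 ^+ k *
  (expR (l.+1%:R * (t * log2_3 R)) * expR (l.+1%:R * - t) *
   expR (k%:R * - t))); last by ring.
congr (_ * _); rewrite -!expRD; congr expR.
rewrite addnS -addSn natrD; ring.
Qed.

Lemma tilt2_gt0 t : 0 < tilt2 t.
Proof. by rewrite divr_gt0 ?expR_gt0. Qed.

Lemma tilt32_gt0 t : 0 < tilt3 t * tilt2 t.
Proof. by rewrite mulr_gt0 ?expR_gt0 ?tilt2_gt0. Qed.

Lemma MX_geometric t : MX R t =
  (\sum_(0 <= l <oo) ((tilt3 t * tilt2 t) ^+ l.+1)%:E *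
     \sum_(0 <= i <oo) (tilt2 t ^+ i.+1)%:E)%E.
Proof.
have y0 := ltW (tilt2_gt0 t).
apply: eq_eseriesr => l _; rewrite -nneseriesZl; last first.
  by move=> i _; rewrite lee_fin exprn_ge0.
rewrite -(@nneseries_addn R
  (fun k => (pmfLr R l k * expR (t * Xval R l k))%:E) 2).
  by apply: eq_eseriesr => i _; rewrite MX_term addn2.
by move=> k; rewrite lee_fin !mulr_ge0 ?exprn_ge0 ?expR_ge0.
Qed.

Lemma MXE t : tilt3 t * tilt2 t < 1 -> tilt2 t < 1 ->
  MX R t = ((tilt3 t * tilt2 t) / (1 - tilt3 t * tilt2 t) *
            (tilt2 t / (1 - tilt2 t)))%:E.
Proof.
move=> x1 y1; have x0 := ltW (tilt32_gt0 t); have y0 := ltW (tilt2_gt0 t).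
rewrite MX_geometric nneseries_geometric ?y0//.
under eq_eseriesr do rewrite muleC.
rewrite nneseriesZl => [|i _]; last by rewrite lee_fin exprn_ge0.
by rewrite nneseries_geometric ?x0// -EFinM mulrC.
Qed.

Lemma MX_lty t : (MX R t < +oo)%E -> tilt3 t * tilt2 t < 1 /\ tilt2 t < 1.
Proof.
have x0 := tilt32_gt0 t; have y0 := tilt2_gt0 t.
have [y1|y1] := ltP (tilt2 t) 1; last first.
  (* An infinite inner series already makes the first outer term infinite. *)
  rewrite MX_geometric nneseries_geometricy//.
  suff -> : (\sum_(0 <= l <oo) ((tilt3 t * tilt2 t) ^+ l.+1)%:E * +oo = +oo)%E.
    by rewrite ltxx.
  apply/eqP; rewrite -leye_eq.
  apply: le_trans (nneseries_lim_ge 1 _).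
    by rewrite big_nat1 expr1 gt0_muley// lte_fin.
  by move=> l _ _; rewrite mule_ge0// lee_fin exprn_ge0// ltW.
have [x1|x1] := ltP (tilt3 t * tilt2 t) 1 => //.
rewrite MX_geometric nneseries_geometric ?ltW//.
under eq_eseriesr do rewrite muleC.
rewrite nneseriesZl => [|i _]; last by rewrite lee_fin exprn_ge0// ltW.
by rewrite nneseries_geometricy// gt0_muley ?ltxx// lte_fin divr_gt0// subr_gt0.
Qed.

(** From 2^3 <= 3^2 and 3 < 2^2. *)
Lemma log2_3_bounds : 3 / 2 <= log2_3 R < 2.
Proof.
have l2 : 0 < ln (2 : R) by rewrite ln_gt0// ltr1n.
rewrite /log2_3 ler_pdivlMr// ltr_pdivrMr//; apply/andP; split.
  have : ln ((2 : R) ^+ 3) <= ln (3 ^+ 2).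
    by rewrite ler_ln ?posrE ?exprn_gt0// -!natrX ler_nat.
  by rewrite !lnXn// -(mulr_natl (ln 2)) -(mulr_natl (ln 3)); lra.
have : ln (3 : R) < ln (2 ^+ 2).
  by rewrite ltr_ln ?posrE ?exprn_gt0// -!natrX ltr_nat.
by rewrite lnXn// -(mulr_natl (ln 2)); lra.
Qed.

(** The exponential Markov step: s <= j log2 3, so the tilt e^(t (j log2 3 - s)) is at least 1. *)
Lemma tilt_weight_ge t (j s : nat) : 0 <= t -> (2 ^ s <= 3 ^ j)%N ->
  2^-1 ^+ s <= tilt3 t ^+ j * tilt2 t ^+ s.
Proof.
move=> t0 h; have l2 : 0 < ln (2 : R) by rewrite ln_gt0// ltr1n.
have sj : s%:R <= j%:R * log2_3 R.
  rewrite /log2_3 mulrA ler_pdivlMr//.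
  have : ln ((2 : R) ^+ s) <= ln (3 ^+ j).
    by rewrite ler_ln ?posrE ?exprn_gt0// -!natrX ler_nat.
  by rewrite !lnXn// -(mulr_natl (ln 2)) -(mulr_natl (ln 3)).
rewrite /tilt3 /tilt2 exprMn mulrA ler_peMl ?exprn_ge0//.
rewrite -!expRM_natl -expRD -[leLHS]expR0 ler_expR.
have -> : j%:R * (t * log2_3 R) + s%:R * - t =
    t * (j%:R * log2_3 R - s%:R) by ring.
by rewrite mulr_ge0// subr_ge0.
Qed.

Lemma MX_ge1 t : t <= 0 -> (MX R t < +oo)%E -> 1 <= fine (MX R t).
Proof.
move=> t0 /MX_lty[x1 y1]; rewrite MXE//=.
have /andP[_ c2] := log2_3_bounds.
rewrite mulf_div ler_pdivlMr ?mul1r; last by rewrite mulr_gt0 ?subr_gt0.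
(* Adding the two tangent bounds gives x + y >= 1 + t (log2 3 - 2) / 2 >= 1. *)
have := expR_ge1Dx (t * log2_3 R - t); have := expR_ge1Dx (- t).
have -> : tilt3 t * tilt2 t = expR (t * log2_3 R - t) / 2.
  by rewrite expRD mulrA.
rewrite /tilt2; nra.
Qed.

(** A uniform lower bound keeps the logarithms meaningful and the supremum in [I0] finite. For t >
    0, x >= e^(t/2) / 2 >= 1/2 gives x/(1-x) >= 1, while x < 1 forces e^(t/2) < 2, hence y = e^-t /
    2 >= 1/8. *)
Lemma MX_ge_inv8 t : (MX R t < +oo)%E -> 8^-1 <= fine (MX R t).
Proof.
move=> Mt; have [t0|t0] := leP t 0.
  by apply: le_trans (MX_ge1 _ t0 Mt); lra.
move: Mt => /MX_lty[x1 y1]; rewrite MXE//=.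
have /andP[c1 _] := log2_3_bounds.
move: x1; have -> : tilt3 t * tilt2 t = expR (t * log2_3 R - t) / 2.
  by rewrite expRD mulrA.
have : expR (t / 2) <= expR (t * log2_3 R - t) by rewrite ler_expR; nra.
set w := expR (t * _ - t) => hw w1.
have e1 : 1 <= expR (t / 2) by rewrite -[leLHS]expR0 ler_expR; lra.
have e2 : tilt2 t = (2 * expR (t / 2) ^+ 2)^-1.
  rewrite /tilt2 -expRM_natl expRN invfM mulrC.
  by congr (_ * (expR _)^-1); field.
have y8 : 8^-1 <= tilt2 t.
  rewrite e2 lef_pV2 ?posrE// ?mulr_gt0 ?exprn_gt0 ?expR_gt0//; nra.
rewrite -[8^-1]mul1r; apply: ler_pM => //.
  by rewrite ler_pdivlMr; lra.
apply: le_trans y8 _; rewrite ler_pdivlMr ?subr_gt0//.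
by have := tilt2_gt0 t; nra.
Qed.

Lemma MX_half_ln2 : (MX R (ln 2 / 2) < +oo)%E /\ fine (MX R (ln 2 / 2)) < 1.
Proof.
have l2 : 0 < ln (2 : R) by rewrite ln_gt0// ltr1n.
set t := ln 2 / 2.
have a3 : tilt3 t ^+ 2 = 3.
  rewrite /tilt3 -expRM_natl /log2_3 /t.
  have -> : 2 * (ln 2 / 2 * (ln 3 / ln 2)) = ln (3 : R).
    by field; rewrite gt_eqF.
  by rewrite lnK// posrE.
have b2 : tilt2 t ^+ 2 = 8^-1.
  rewrite /tilt2 exprMn -expRM_natl /t.
  have -> : 2 * - (ln 2 / 2) = - ln (2 : R) by field.
  by rewrite expRN lnK ?posrE//; field.
have a0 : 0 < tilt3 t by exact: expR_gt0.
have b0 := tilt2_gt0 t.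
(* Here u = sqrt 3 and y = 1 / sqrt 8; these rational upper bounds are sharp enough for uy + y <
   1. *)
have a1 : tilt3 t < 7 / 4 by nra.
have b1 : tilt2 t < 71 / 200 by nra.
have x1 : tilt3 t * tilt2 t < 1 by nra.
rewrite MXE//=; last by lra.
split; first exact: ltry.
rewrite mulf_div ltr_pdivrMr ?mul1r; last by rewrite mulr_gt0 ?subr_gt0//; lra.
nra.
Qed.

Lemma I0_ubound : has_ubound
  [set - ln (fine (MX R t)) | t in [set t : R | (MX R t < +oo)%E]].
Proof.
exists (ln 8) => _ [t /= /MX_ge_inv8 h <-].
rewrite lerNl -lnV ?posrE// ler_ln ?posrE ?invr_gt0//.
exact: lt_le_trans h.
Qed.

Lemma I0_gt0 : 0 < I0 R.
Proof.
have [fin lt1] := MX_half_ln2.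
apply: (@lt_le_trans _ _ (- ln (fine (MX R (ln 2 / 2))))); last first.
  by apply: ub_le_sup; [exact: I0_ubound|exists (ln 2 / 2)].
rewrite oppr_gt0 ln_lt0// lt1 andbT.
by apply: lt_le_trans (MX_ge_inv8 _ fin).
Qed.

End moment.

(** * The Chernoff bound and its optimisation over t *)

Section chernoff.
Context {R : realType}.

Lemma upper_density_le_MX (t : R) (k : nat) : (MX R t < +oo)%E ->
  (upper_density R (Nset k) <= (fine (MX R t) ^+ k)%:E)%E.
Proof.
move=> Mt; have [t0|t0] := leP t 0.
  apply: le_trans (upper_density_le _ _ (density_le1 _)) _.
  by rewrite lee_fin exprn_ege1// MX_ge1.
have [x1 y1] := MX_lty _ Mt.
apply: (upper_density_Nset (tilt3 t) (tilt2 t)); rewrite ?MXE//.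
- exact: expR_ge0.
- by rewrite ltW ?tilt2_gt0.
- by move=> j s; apply: tilt_weight_ge; exact: ltW.
Qed.

Lemma upper_density_le_I0 (k : nat) : (1 <= k)%N ->
  (upper_density R (Nset k) <= (expR (- (I0 R * k%:R)))%:E)%E.
Proof.
move=> k1; have := upper_density_le _ _ (density_le1 (R := R) (Nset k)).
have := upper_density_ge0 (R := R) (Nset k).
have := upper_density_le_MX ^~ k.
case: (upper_density _ _) => [d| |]// hM.
(* Density 0 is treated apart because logarithms are taken next; for d > 0 the goal becomes I(0) <=
   -(ln d)/k, checked on each member of the set. *)
rewrite !lee_fin le_eqVlt => /orP[/eqP <- _|d0 d1]; first exact: expR_ge0.
have k0 : 0 < k%:R :> R by rewrite ltr0n.
rewrite -[leLHS]lnK ?posrE// ler_expR lerNr -ler_pdivlMr// mulNr.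
apply: ge_sup.
  (* The supremum is over a nonempty set. *)
  exists (- ln (fine (MX R (ln 2 / 2)))), (ln 2 / 2) => //.
  by case: (@MX_half_ln2 R).
move=> _ [t /= Mt <-]; rewrite lerN2 ler_pdivrMr// mulr_natr.
have m0 : 0 < fine (MX R t) by apply: lt_le_trans (MX_ge_inv8 _ Mt).
by rewrite -lnXn// ler_ln ?posrE ?exprn_gt0// -lee_fin hM.
Qed.

End chernoff.

Theorem mainTheorem2 (R : realType) :
  (forall k : nat, (1 <= k)%N ->
     (upper_density R (Nset k) <= (expR (- (I0 R * k%:R)))%:E)%E) /\
  upper_density R (\bigcap_(k in [set k : nat | (1 <= k)%N]) Nset k) = 0%E.
Proof.
split; first exact: upper_density_le_I0.
apply/eqP; rewrite eq_le upper_density_ge0 andbT.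
apply/lee_addgt0Pr => e e0; rewrite add0e.
(* With I(0) > 0 this gives e^(I(0) k) >= 1 + I(0) k >= 1/e, where the last e is the tolerance. *)
pose k := (Num.truncn (e^-1 / I0 R)).+1.
apply: (@le_trans _ _ (upper_density R (Nset k))).
  by apply: upper_density_subset => n _; apply.
apply: le_trans (upper_density_le_I0 k isT) _.
rewrite lee_fin expRN invf_ple ?posrE ?expR_gt0//.
apply: le_trans (expR_ge1Dx _).
have : e^-1 / I0 R < k%:R by exact: truncnS_gt.
rewrite ltr_pdivrMr ?I0_gt0// mulrC => /ltW h.
by apply: le_trans h _; rewrite lerDr.
Qed.
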